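(* Let $A, R_L, C_L, f_c>0$, $\omega_c=2\pi f_c$, $\tau = R_L C_L$ and $\delta = \sqrt{R_L/(1+\omega_c^2\tau^2)}$. Let $g(x)=|x|$ (full-wave rectifier) or $g(x)=\max(0,x)$ (half-wave rectifier), and let $v_{\rm o}(t)$ be the output of the low-pass RC filter driven by the rectifier output $v_{\rm out}(t)=g(\delta A\cos(\omega_c t))$, $0\le t\le T$, where $T$ is the duration of the waveform, as defined in the context. Then the DC voltage $V_{\rm DC}=\mathbb{E}_t\{v_{\rm o}(t)\}$, i.e. the average of $v_{\rm o}(t)$ over the waveform duration, is $$V_{\rm DC} = \mathbb{E}_t\{v_{\rm o}(t)\} = \delta A R_L\frac{a_0}{2},$$ where $a_0$ is the Fourier coefficient that contributes to the DC component, which is $a_0 = 4/\pi$ for the full-wave rectifier and $a_0 = 2/\pi$ for the half-wave rectifier. Thus the DC voltage achieved by the full-wave rectifier is double that achieved by the half-wave rectifier.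
   Context: The source transmits the sinewave $x(t)=A\cos(2\pi f_c t)$, $0\le t\le T$, with amplitude $A$, carrier frequency $f_c$ and waveform duration $T$; the rectifier input voltage is $v_{\rm in}(t)=\delta A\cos(\omega_c t)$, where $R_L$ and $C_L$ are the load resistance and capacitance of the RC filter. The operator $\mathbb{E}_t\{\cdot\}$ denotes the average over the waveform duration. Let $a_k = 2f_c\int_{-1/(2f_c)}^{1/(2f_c)} g(\cos(2\pi f_c t))\cos(2\pi k f_c t)\,dt$ ($k\ge 0$) be the cosine Fourier coefficients of $t\mapsto g(\cos(\omega_c t))$ (the sine coefficients vanish). Put $d_k = |a_k|$, and $\phi_k=0$ if $a_k>0$, $\phi_k=\pi$ otherwise, so that $$v_{\rm out}(t)=\delta A\left(\frac{a_0}{2}+\sum_{k=1}^\infty d_k\cos(\omega_c k t+\phi_k)\right).$$ The parallel RC filter has transfer function $H(f)=\dfrac{R_L}{1+\jmath 2\pi f R_L C_L}$ with $\jmath=\sqrt{-1}$, so $|H(kf_c)| = R_L/\sqrt{1+(2\pi k f_c\tau)^2}$ and $\angle H(kf_c)=\tan^{-1}(-2\pi k f_c\tau)$. The filter output is $$v_{\rm o}(t)=\delta A\left(\frac{a_0R_L}{2}+\sum_{k=1}^\infty |H(kf_c)|\,d_k\cos\big(\omega_c k t+\phi_k+\angle H(kf_c)\big)\right).$$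
   Formalization: The waveform duration T is assumed to be a whole number of carrier periods, T = n/f_c with n ≥ 1; for arbitrary T the stated equality fails (e.g. half-wave rectifier with T = 1/(2f_c)). *)

(* Defs.v *)
From Stdlib Require Import Reals.
From Coquelicot Require Import Coquelicot.
Open Scope R_scope.

Inductive rectifier : Set := full_wave | half_wave.

Definition rectify (r : rectifier) (x : R) : R :=
  match r with
  | full_wave => Rabs x
  | half_wave => Rmax 0 x
  end.

Definition omega (fc : R) : R := 2 * PI * fc.

Definition delta (RL CL fc : R) : R :=
  let tau := RL * CL in
  sqrt (RL / (1 + omega fc ^ 2 * tau ^ 2)).

(* Cosine Fourier coefficients of [t |-> g (cos (2 PI fc t))] over one carrier
   period; the series below uses [fourier_coef g fc 0 / 2] as constant term. *)
Definition fourier_coef (g : R -> R) (fc : R) (k : nat) : R :=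
  2 * fc * RInt (fun t => g (cos (2 * PI * fc * t)) * cos (2 * PI * INR k * fc * t))
             (- (1 / (2 * fc))) (1 / (2 * fc)).

Definition harmonic_ampl (g : R -> R) (fc : R) (k : nat) : R :=
  Rabs (fourier_coef g fc k).

Definition harmonic_phase (g : R -> R) (fc : R) (k : nat) : R :=
  if Rlt_dec 0 (fourier_coef g fc k) then 0 else PI.

Definition rc_transfer (RL CL f : R) : C :=
  (RtoC RL / (RtoC 1 + Ci * RtoC (2 * PI * f * RL * CL)))%C.

(* Principal argument of [rc_transfer RL CL f]: the real part is positive for
   [RL > 0], so the arctangent needs no quadrant correction, and the quotient
   equals [- 2 PI f RL CL]. *)
Definition rc_angle (RL CL f : R) : R :=
  atan (Im (rc_transfer RL CL f) / Re (rc_transfer RL CL f)).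

Definition output_harmonic (g : R -> R) (RL CL fc t : R) (k : nat) : R :=
  Cmod (rc_transfer RL CL (INR k * fc)) * harmonic_ampl g fc k
  * cos (omega fc * INR k * t + harmonic_phase g fc k + rc_angle RL CL (INR k * fc)).

(* Filter output for the rectifier output [g (delta A cos (omega t))]; as [g] is
   positively homogeneous, the factor [delta A] comes out of the coefficients. *)
Definition v_o (g : R -> R) (A RL CL fc t : R) : R :=
  delta RL CL fc * A
  * (fourier_coef g fc 0 * RL / 2
     + Series (fun k => output_harmonic g RL CL fc t (S k))).

Definition time_average (T : R) (v : R -> R) : R := RInt v 0 T / T.

Definition V_DC (g : R -> R) (A RL CL fc T : R) : R :=
  time_average T (v_o g A RL CL fc).

(* Main.v *)
(** Each harmonic of the filter output integrates to zero over a whole number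
    of carrier periods, so only the constant term survives once the average is
    exchanged with the sum.  The exchange holds by the Weierstrass M-test: the
    [k]-th Fourier coefficient of the rectified cosine is [O(1/k)], because the
    rectified cosine is a multiple of the cosine on each of three intervals, and
    the filter gain contributes another factor [O(1/k)]. *)
Require Import Defs.
From Stdlib Require Import Reals Lra Lia.
From Coquelicot Require Import Coquelicot.
Open Scope R_scope.

(** * Dominated series and term-by-term integration *)

Lemma ex_series_dominated (a M : nat -> R) :
  (forall k, Rabs (a k) <= M k) -> ex_series M -> ex_series a.
Proof.
  intros H HM. apply (ex_series_le a M); [exact H | exact HM].
Qed.

(** The error is the tail of [a], dominated termwise by the tail of [M]. The bound mentions only
    [M], so for a series of functions it is uniform in the variable. *)
Lemma Series_partial_sum_error (a M : nat -> R) (n : nat) :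
  (forall k, Rabs (a k) <= M k) -> ex_series M ->
  Rabs (sum_n a n - Series a) <= Series M - sum_n M n.
Proof.
  intros H HM.
  assert (Ha : ex_series a) by (eapply ex_series_dominated; eauto).
  rewrite (Series_incr_n a (S n)), (Series_incr_n M (S n)) by (lia || assumption).
  rewrite !sum_n_Reals. simpl pred.
  assert (HMn : ex_series (fun k => M (S n + k)%nat)) by now apply ex_series_incr_n.
  replace (sum_f_R0 a n - (sum_f_R0 a n + Series (fun k => a (S n + k)%nat)))
    with (- Series (fun k => a (S n + k)%nat)) by ring.
  rewrite Rabs_Ropp.
  apply Rle_trans with (Series (fun k => Rabs (a (S n + k)%nat))).
  - apply Series_Rabs.
    apply (ex_series_dominated _ (fun k => M (S n + k)%nat)); auto.
    intros k. rewrite Rabs_Rabsolu. apply H.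
  - apply Rle_trans with (Series (fun k => M (S n + k)%nat)); [|lra].
    apply Series_le; auto.
    intros k; split; [apply Rabs_pos | apply H].
Qed.

Lemma is_RInt_sum_n (f : nat -> R -> R) (I : nat -> R) (a b : R) (n : nat) :
  (forall k, is_RInt (f k) a b (I k)) ->
  is_RInt (fun t => sum_n (fun k => f k t) n) a b (sum_n I n).
Proof.
  intros H. induction n as [|n IH].
  - rewrite sum_O. apply is_RInt_ext with (f 0%nat); [|apply H].
    intros t _. now rewrite sum_O.
  - rewrite sum_Sn.
    apply is_RInt_ext with (fun t => plus (sum_n (fun k => f k t) n) (f (S n) t)).
    + intros t _. now rewrite sum_Sn.
    + apply @is_RInt_plus; [exact IH | apply H].
Qed.

Lemma is_RInt_Series (f : nat -> R -> R) (I M : nat -> R) (a b : R) :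
  (forall k, is_RInt (f k) a b (I k)) ->
  (forall k t, Rabs (f k t) <= M k) -> ex_series M ->
  is_RInt (fun t => Series (fun k => f k t)) a b (Series I).
Proof.
  intros HI HM EM.
  destruct (filterlim_RInt (fun n t => sum_n (fun k => f k t) n) a b eventually _
              (fun t => Series (fun k => f k t)) (sum_n I))
    as [If [Hlim Hint]].
  - intros n. now apply is_RInt_sum_n.
  (* Convergence in the function space is uniform: the rank [n] comes from the tail of [M] alone,
     before [t] is introduced. *)
  - apply filterlim_locally. intros eps.
    pose proof (Series_correct M EM) as HS.
    pose proof (proj1 (filterlim_locally _ _) HS eps) as HE.
    revert HE. apply filter_imp. intros n Hn t.
    change (Rabs (sum_n M n - Series M) < eps) in Hn.
    change (Rabs (sum_n (fun k => f k t) n - Series (fun k => f k t)) < eps).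
    eapply Rle_lt_trans; [apply Series_partial_sum_error with (M := M); auto|].
    eapply Rle_lt_trans; [|exact Hn].
    rewrite Rabs_minus_sym. apply Rle_abs.
  - replace (Series I) with If; [exact Hint|].
    symmetry. now apply is_series_unique.
Qed.

(** Telescoping: each term is 1/(k+1) - 1/(k+2). This is the model majorant for the M-test. *)
Lemma is_series_inv_mul_succ :
  is_series (fun k => / (INR (k + 1) * INR (k + 2))) 1.
Proof.
  assert (E : forall n, 1 - / INR (n + 2)
                        = sum_n (fun k => / (INR (k + 1) * INR (k + 2))) n).
  { induction n as [|n IH].
    - rewrite sum_O. simpl. field.
    - rewrite sum_Sn, <- IH. change plus with Rplus.
      rewrite !plus_INR, !S_INR. change (INR 0) with 0.
      pose proof (pos_INR n). field. lra. }
  change (is_lim_seq (sum_n (fun k => / (INR (k + 1) * INR (k + 2)))) 1).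
  eapply is_lim_seq_ext; [exact E|].
  replace (Finite 1) with (Finite (1 - 0)) by (f_equal; ring).
  apply is_lim_seq_minus'; [apply is_lim_seq_const|].
  apply (is_lim_seq_incr_n (fun n => / INR n) 2).
  replace (Finite 0) with (Rbar_inv p_infty) by reflexivity.
  apply is_lim_seq_inv; [apply is_lim_seq_INR | discriminate].
Qed.

(** * Fourier coefficients of the rectified cosine *)

Definition negative_gain (r : rectifier) : R :=
  match r with full_wave => -1 | half_wave => 0 end.

Lemma rectify_nonneg (r : rectifier) (x : R) : 0 <= x -> rectify r x = x.
Proof.
  intros Hx. destruct r; simpl.
  - now apply Rabs_pos_eq.
  - now apply Rmax_right.
Qed.

Lemma rectify_nonpos (r : rectifier) (x : R) :
  x <= 0 -> rectify r x = negative_gain r * x.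
Proof.
  intros Hx. destruct r; simpl.
  - rewrite Rabs_left1 by assumption. ring.
  - rewrite Rmax_left by assumption. ring.
Qed.

(** The integrand need only agree with [c * f] on the interval, which suits the rectified cosine: it
    has kinks, but is a multiple of a smooth function between them. *)
Lemma is_RInt_scaled_derive (h f F : R -> R) (c a b : R) :
  a <= b ->
  (forall x, is_derive F x (f x)) -> (forall x, continuous f x) ->
  (forall x, a <= x <= b -> h x = c * f x) ->
  is_RInt h a b (c * (F b - F a)).
Proof.
  intros Hab HF Hf Hh.
  apply is_RInt_ext with (fun x => scal c (f x)).
  - intros x Hx. rewrite Rmin_left, Rmax_right in Hx by assumption.
    symmetry. apply Hh. lra.
  - apply (is_RInt_scal f a b c (minus (F b) (F a))).
    apply (is_RInt_derive F f); auto.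
Qed.

(** Here [q] is a quarter period: the cosine is nonnegative on [-q, q] and nonpositive on the two
    outer quarters. The primitive [F] stays abstract because harmonic 0 and the harmonics from 2 on
    need different formulas. *)
Lemma rectified_fourier_coef (r : rectifier) (fc : R) (k : nat) (F : R -> R) :
  0 < fc ->
  (forall x, is_derive F x
     (cos (2 * PI * fc * x) * cos (2 * PI * INR k * fc * x))) ->
  let q := 1 / (4 * fc) in
  fourier_coef (rectify r) fc k
  = 2 * fc * (negative_gain r * (F (- q) - F (- (2 * q))) + (F q - F (- q))
              + negative_gain r * (F (2 * q) - F q)).
Proof.
  intros Hfc HF q. unfold fourier_coef. f_equal.
  replace (1 / (2 * fc)) with (2 * q) by (unfold q; field; lra).
  assert (Hq : 0 < q) by (unfold q; apply Rdiv_lt_0_compat; lra).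
  pose proof PI_RGT_0 as HPI.
  assert (Hw : 2 * PI * fc * q = PI / 2) by (unfold q; field; lra).
  assert (Hm : forall x y, x <= y -> 2 * PI * fc * x <= 2 * PI * fc * y).
  { intros x y. apply Rmult_le_compat_l.
    apply Rmult_le_pos; [lra|lra]. }
  set (f := fun x => cos (2 * PI * fc * x) * cos (2 * PI * INR k * fc * x)) in *.
  assert (Hf : forall x, continuous f x).
  { intros x. apply (ex_derive_continuous f). unfold f. auto_derive. auto. }
  apply is_RInt_unique.
  apply @is_RInt_Chasles with q; [apply @is_RInt_Chasles with (- q)|].
  - apply (is_RInt_scaled_derive _ f F); auto; [lra|].
    intros x [H1 H2]. unfold f. rewrite rectify_nonpos; [ring|].
    (* Evenness moves the angle from [-PI, -PI/2] to [PI/2, PI]. *)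
    rewrite <- cos_neg.
    apply Hm in H1. apply Hm in H2. apply cos_le_0; lra.
  - rewrite <- (Rmult_1_l (F q - F (- q))).
    apply (is_RInt_scaled_derive _ f F); auto; [lra|].
    intros x [H1 H2]. unfold f. rewrite rectify_nonneg; [ring|].
    apply Hm in H1. apply Hm in H2. apply cos_ge_0; lra.
  - apply (is_RInt_scaled_derive _ f F); auto; [lra|].
    intros x [H1 H2]. unfold f. rewrite rectify_nonpos; [ring|].
    apply Hm in H1. apply Hm in H2. apply cos_le_0; lra.
Qed.

(** The cosine integrates to 2/w over the middle half period and to -1/w over each outer quarter,
    with w = 2 PI fc; hence the factor [1 - negative_gain r]. *)
Lemma rectified_fourier_coef_0 (r : rectifier) (fc : R) :
  0 < fc -> fourier_coef (rectify r) fc 0 = 2 * (1 - negative_gain r) / PI.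
Proof.
  intros Hfc. pose proof PI_RGT_0 as HPI.
  rewrite (rectified_fourier_coef r fc 0
             (fun x => sin (2 * PI * fc * x) / (2 * PI * fc)) Hfc).
  - cbv beta.
    replace (2 * PI * fc * - (2 * (1 / (4 * fc)))) with (- PI) by (field; lra).
    replace (2 * PI * fc * (2 * (1 / (4 * fc)))) with PI by (field; lra).
    replace (2 * PI * fc * - (1 / (4 * fc))) with (- (PI / 2)) by (field; lra).
    replace (2 * PI * fc * (1 / (4 * fc))) with (PI / 2) by (field; lra).
    rewrite !sin_neg, sin_PI2, sin_PI. field. lra.
  - intros x. auto_derive; [auto|].
    simpl INR.
    replace (2 * PI * 0 * fc * x) with 0 by ring. rewrite cos_0.
    field. lra.
Qed.

Lemma Rabs_sin_div_le (x c d : R) : 0 < d -> d <= c -> Rabs (sin x / c) <= / d.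
Proof.
  intros Hd Hc. unfold Rdiv. rewrite Rabs_mult, Rabs_inv, (Rabs_pos_eq c) by lra.
  rewrite <- (Rmult_1_l (/ d)).
  apply Rmult_le_compat; [apply Rabs_pos | left; apply Rinv_0_lt_compat; lra | |].
  - apply Rabs_le. pose proof (SIN_bound x). lra.
  - apply Rinv_le_contravar; lra.
Qed.

(** The product-to-sum primitive for harmonic k divides by k - 1 and k + 1, so the bound starts at k
    = j + 2, with m = k - 1. *)
Lemma rectified_fourier_coef_bound (r : rectifier) (fc : R) (j : nat) :
  0 < fc ->
  Rabs (fourier_coef (rectify r) fc (j + 2)) <= 6 / PI * / INR (j + 1).
Proof.
  intros Hfc. pose proof PI_RGT_0 as HPI. pose proof (pos_INR j) as Hj.
  assert (HP : 0 < PI * fc) by now apply Rmult_lt_0_compat.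
  set (w := 2 * PI * fc).
  assert (Hw : 0 < w) by (unfold w; lra).
  set (m := INR (j + 1)).
  assert (Hm : 0 < m) by (unfold m; rewrite plus_INR; simpl; lra).
  assert (Hk : INR (j + 2) = m + 1) by (unfold m; rewrite !plus_INR; simpl; ring).
  (* A primitive of cos(wx) cos((m+1)wx), written as half the sum of cos((m+2)wx) and cos(mwx). *)
  set (F := fun x => (sin ((m + 2) * w * x) / ((m + 2) * w)
                      + sin (m * w * x) / (m * w)) / 2).
  assert (Hmw : 0 < m * w) by now apply Rmult_lt_0_compat.
  assert (HB : forall x, Rabs (F x) <= / (m * w)).
  { intros x. unfold F.
    pose proof (Rabs_sin_div_le ((m + 2) * w * x) ((m + 2) * w) (m * w) Hmw ltac:(lra)).
    pose proof (Rabs_sin_div_le (m * w * x) (m * w) (m * w) Hmw ltac:(lra)).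
    apply Rabs_le_between in H. apply Rabs_le_between in H0.
    apply Rabs_le. lra. }
  rewrite (rectified_fourier_coef r fc (j + 2) F Hfc).
  - cbv zeta. set (q := 1 / (4 * fc)).
    (* The 6 counts the values of [F] in the three differences, each at most 1/(mw) in absolute
       value and weighted by a gain in [-1, 1]. *)
    replace (6 / PI * / m) with (2 * fc * (6 * / (m * w)))
      by (unfold w; field; lra).
    rewrite Rabs_mult, (Rabs_pos_eq (2 * fc)) by lra.
    apply Rmult_le_compat_l; [lra|].
    pose proof (HB q) as H1. pose proof (HB (- q)) as H2.
    pose proof (HB (2 * q)) as H3. pose proof (HB (- (2 * q))) as H4.
    apply Rabs_le_between in H1, H2, H3, H4.
    apply Rabs_le. destruct r; simpl negative_gain; lra.
  - intros x. rewrite Hk. unfold F. auto_derive; [auto|].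
    replace (2 * PI * (m + 1) * fc * x) with (m * w * x + w * x)
      by (unfold w; ring).
    replace ((m + 2) * w * x) with ((m * w * x + w * x) + w * x) by ring.
    replace (cos (m * w * x)) with (cos ((m * w * x + w * x) - w * x))
      by (f_equal; ring).
    fold w. rewrite (cos_plus (m * w * x + w * x)), cos_minus. field. lra.
Qed.

(** * Decay of the filter gain and convergence of the output series *)

Lemma rc_gain_bound (RL CL f : R) :
  0 < RL -> 0 < CL -> 0 < f -> Cmod (rc_transfer RL CL f) <= / (omega f * CL).
Proof.
  intros HR HC Hf. pose proof PI_RGT_0 as HPI. unfold rc_transfer, omega.
  set (x := 2 * PI * f * RL * CL).
  assert (Hx : 0 < x).
  { unfold x. repeat (apply Rmult_lt_0_compat; [|assumption]). lra. }
  set (z := (RtoC 1 + Ci * RtoC x)%C).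
  (* The modulus of the denominator is at least its imaginary part, which is linear in the
     frequency. *)
  assert (Hz : x <= Cmod z).
  { eapply Rle_trans; [|apply Rmax_Cmod].
    eapply Rle_trans; [|apply Rmax_r].
    unfold z; simpl. eapply Rle_trans; [|apply Rle_abs]. lra. }
  rewrite Cmod_div by (intros H; rewrite H, Cmod_0 in Hz; lra).
  rewrite Cmod_R, Rabs_pos_eq by lra.
  replace (/ (2 * PI * f * CL)) with (RL / x)
    by (unfold x; field; repeat split; lra).
  apply Rmult_le_compat_l; [lra|]. apply Rinv_le_contravar; lra.
Qed.

Definition harmonic_bound (g : R -> R) (RL CL fc : R) (k : nat) : R :=
  Cmod (rc_transfer RL CL (INR k * fc)) * harmonic_ampl g fc k.

Lemma output_harmonic_bound (g : R -> R) (RL CL fc t : R) (k : nat) :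
  Rabs (output_harmonic g RL CL fc t k) <= harmonic_bound g RL CL fc k.
Proof.
  unfold output_harmonic, harmonic_bound, harmonic_ampl.
  set (c := cos _). set (B := Cmod _ * Rabs _).
  assert (HB : 0 <= B) by (apply Rmult_le_pos; [apply Cmod_ge_0 | apply Rabs_pos]).
  rewrite Rabs_mult, (Rabs_pos_eq B HB).
  rewrite <- (Rmult_1_r B) at 2. apply Rmult_le_compat_l; auto.
  apply Rabs_le. unfold c. apply COS_bound.
Qed.

Lemma ex_series_harmonic_bound (r : rectifier) (RL CL fc : R) :
  0 < RL -> 0 < CL -> 0 < fc ->
  ex_series (fun k => harmonic_bound (rectify r) RL CL fc (S k)).
Proof.
  intros HR HC Hfc. pose proof PI_RGT_0 as HPI.
  (* Harmonic 1 is split off, since the coefficient bound starts at harmonic 2. *)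
  apply ex_series_incr_1.
  set (K := 6 / PI * / (omega fc * CL)).
  apply (ex_series_dominated _
           (fun k => K * / (INR (k + 1) * INR (k + 2)))).
  2: { apply (ex_series_scal_l K (fun k => / (INR (k + 1) * INR (k + 2)))).
       eexists. apply is_series_inv_mul_succ. }
  intros k. replace (S (S k)) with (k + 2)%nat by lia.
  unfold harmonic_bound, harmonic_ampl.
  assert (H2 : 0 < INR (k + 2)) by (apply lt_0_INR; lia).
  assert (H1 : 0 < INR (k + 1)) by (apply lt_0_INR; lia).
  rewrite Rabs_pos_eq
    by (apply Rmult_le_pos; [apply Cmod_ge_0 | apply Rabs_pos]).
  replace (K * / (INR (k + 1) * INR (k + 2)))
    with (/ (omega (INR (k + 2) * fc) * CL) * (6 / PI * / INR (k + 1)))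
    by (unfold K, omega; field; repeat split; lra).
  apply Rmult_le_compat; [apply Cmod_ge_0 | apply Rabs_pos | |].
  - apply rc_gain_bound; auto. now apply Rmult_lt_0_compat.
  - now apply rectified_fourier_coef_bound.
Qed.

(** * Averages over whole carrier periods *)

Lemma is_RInt_output_harmonic (g : R -> R) (RL CL fc : R) (n k : nat) :
  0 < fc ->
  is_RInt (fun t => output_harmonic g RL CL fc t (S k)) 0 (INR n / fc) 0.
Proof.
  intros Hfc. pose proof PI_RGT_0 as HPI. unfold output_harmonic.
  set (B := _ * harmonic_ampl g fc (S k)).
  set (p := harmonic_phase g fc (S k)).
  set (q := rc_angle RL CL (INR (S k) * fc)).
  assert (Hk : 0 < INR (S k)) by (apply lt_0_INR; lia).
  set (w := omega fc * INR (S k)).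
  assert (Hw : 0 < w).
  { unfold w, omega. repeat (apply Rmult_lt_0_compat; [|assumption]). lra. }
  set (F := fun t => sin (w * t + p + q) / w).
  assert (HF : F (INR n / fc) - F 0 = 0).
  { unfold F.
    (* Harmonic k + 1 completes (k+1)n full turns over n carrier periods, so the sine primitive
       agrees at both ends. *)
    replace (w * (INR n / fc) + p + q)
      with ((w * 0 + p + q) + 2 * INR (S k * n) * PI)
      by (unfold w, omega; rewrite mult_INR; field; lra).
    rewrite sin_period. ring. }
  evar_last.
  - apply (is_RInt_scaled_derive _ (fun t => cos (w * t + p + q)) F B).
    + apply Rmult_le_pos; [apply pos_INR | left; now apply Rinv_0_lt_compat].
    + intros x. unfold F. auto_derive; [auto|]. field. lra.
    + intros x. apply (ex_derive_continuous (fun t => cos (w * t + p + q))).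
      auto_derive. auto.
    + reflexivity.
  - now rewrite HF, Rmult_0_r.
Qed.

Lemma is_RInt_v_o (r : rectifier) (A RL CL fc : R) (n : nat) :
  0 < RL -> 0 < CL -> 0 < fc ->
  is_RInt (v_o (rectify r) A RL CL fc) 0 (INR n / fc)
    (INR n / fc * (delta RL CL fc * A * RL * (fourier_coef (rectify r) fc 0 / 2))).
Proof.
  intros HR HC Hfc. unfold v_o.
  set (D := delta RL CL fc * A). set (a := fourier_coef (rectify r) fc 0).
  assert (HS := is_RInt_Series
                  (fun k t => output_harmonic (rectify r) RL CL fc t (S k))
                  (fun _ => 0) (fun k => harmonic_bound (rectify r) RL CL fc (S k))
                  0 (INR n / fc)
                  (fun k => is_RInt_output_harmonic (rectify r) RL CL fc n k Hfc)
                  (fun k t => output_harmonic_bound (rectify r) RL CL fc t (S k))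
                  (ex_series_harmonic_bound r RL CL fc HR HC Hfc)).
  replace (Series (fun _ => 0)) with 0 in HS.
  (* Writing the zero terms as multiples of 0 lets linearity evaluate the sum. *)
  2: { rewrite (Series_ext _ (fun _ => 0 * 0)) by (intros; ring).
       rewrite Series_scal_l. ring. }
  assert (HP := is_RInt_scal _ _ _ D _
                  (is_RInt_plus _ _ _ _ _ _
                     (is_RInt_const 0 (INR n / fc) (a * RL / 2)) HS)).
  replace (INR n / fc * (D * RL * (a / 2)))
    with (scal D (plus (scal (INR n / fc - 0) (a * RL / 2)) 0)); [exact HP|].
  unfold scal, plus; simpl. unfold mult; simpl. field. lra.
Qed.

Lemma V_DC_rectify (r : rectifier) (A RL CL fc : R) (n : nat) :
  0 < RL -> 0 < CL -> 0 < fc -> (0 < n)%nat ->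
  V_DC (rectify r) A RL CL fc (INR n / fc)
  = delta RL CL fc * A * RL * (fourier_coef (rectify r) fc 0 / 2).
Proof.
  intros HR HC Hfc Hn. unfold V_DC, time_average.
  rewrite (is_RInt_unique _ _ _ _ (is_RInt_v_o r A RL CL fc n HR HC Hfc)).
  apply lt_0_INR in Hn. field. lra.
Qed.

(* [Series] and [RInt] are total operators: the first two conjuncts say that the
   series defining [v_o] converges and that [v_o] is Riemann integrable. *)
Theorem mainTheorem2 :
  forall (A RL CL fc T : R) (n : nat),
    0 < A -> 0 < RL -> 0 < CL -> 0 < fc ->
    (0 < n)%nat -> T = INR n / fc ->
    (forall r : rectifier,
        (forall t : R,
            ex_series (fun k => output_harmonic (rectify r) RL CL fc t (S k))) /\
        ex_RInt (v_o (rectify r) A RL CL fc) 0 T /\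
        V_DC (rectify r) A RL CL fc T
        = delta RL CL fc * A * RL * (fourier_coef (rectify r) fc 0 / 2)) /\
    fourier_coef (rectify full_wave) fc 0 = 4 / PI /\
    fourier_coef (rectify half_wave) fc 0 = 2 / PI /\
    V_DC (rectify full_wave) A RL CL fc T
    = 2 * V_DC (rectify half_wave) A RL CL fc T.
Proof.
  intros A RL CL fc T n HA HR HC Hfc Hn ->.
  pose proof PI_RGT_0 as HPI.
  split; [|split; [|split]].
  - intros r. split; [|split].
    + intros t.
      apply (ex_series_dominated _
               (fun k => harmonic_bound (rectify r) RL CL fc (S k))).
      * intros k. apply output_harmonic_bound.
      * now apply ex_series_harmonic_bound.
    + eexists. now apply is_RInt_v_o.
    + now apply V_DC_rectify.
  - rewrite rectified_fourier_coef_0 by assumption. simpl. field. lra.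
  - rewrite rectified_fourier_coef_0 by assumption. simpl. field. lra.
  (* The ratio 2 is that of [1 - negative_gain r]: 2 for the full wave, 1 for the half wave. *)
  - rewrite !V_DC_rectify, !rectified_fourier_coef_0 by assumption.
    simpl. field. lra.
Qed.
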